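(* Let $\Gamma=\Gamma(F,W)$ be a decorated splice diagram and let $e$ be a special edge of $\Gamma$ with end nodes $v_L,v_R$. Splice $\Gamma$ along $e$ into $\Gamma_L=\Gamma_L(F_L,W_L)\ni v_L$ and $\Gamma_R=\Gamma_R(F_R,W_R)\ni v_R$. Write $(N,\nu)=(N_{v_L},\nu_{v_L})$, and let $(M,i)=(M_{v_Le},i_{v_Le})$, $(M',i')=(M_{v_Re},i_{v_Re})$ be the decorations of the new leaf of $\Gamma_L$ and of the new leaf of $\Gamma_R$, respectively (so $M'=0$ if there are no arrowheads of $\Gamma$ on the side of $v_L$). Assume $i_\ell\neq0$ for every boundary vertex $\ell$ of $\Gamma$, of $\Gamma_L$ and of $\Gamma_R$ (so that the three zeta functions are defined). Then: (1) $$Z(\Gamma;s)=Z(\Gamma_L;s)+Z(\Gamma_R;s)-\frac{1}{(i+sM)(i'+sM')}.$$ (2) The contribution of $v_L$ in $Z(\Gamma;s)$ has $-\nu/N$ as a pole of order $2$ if and only if the contribution of $v_L$ in $Z(\Gamma_L;s)$ has $-\nu/N$ as a pole of order $2$. (3) Suppose that $-\nu/N$ is not a pole of order $2$ of $Z(\Gamma;s)$. Then the contribution of $v_L$ to the residue of $Z(\Gamma;s)$ at $-\nu/N$ and the contribution of $v_L$ to the residue of $Z(\Gamma_L;s)$ at $-\nu/N$ are equal.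
   Context: DIAGRAMS. A splice diagram $\Gamma$ is a finite tree whose vertices are nodes (valency $\ge 3$) and leaves (valency $1$). Every pair (node $v$, edge $e$ at $v$) carries a weight $d_{ve}\in\mathbb{Z}_{\ge 1}$; the weights at a fixed node are pairwise coprime; and for every special edge $e$ (an edge joining two nodes $v,w$) the edge determinant $q_e=d_{ve}d_{we}-\prod_{e_1\ne e \text{ at } v}d_{ve_1}\prod_{e_2\neq e\text{ at }w}d_{we_2}$ is positive. $\delta_v$ denotes the valency of $v$. A diagram $\Gamma(F)$ is a splice diagram with an integer $N_\ell\ge 0$ at each leaf $\ell$, not all zero (this encodes an effective non-zero divisor $F$); a leaf is called an arrowhead if $N_\ell>0$ and a boundary vertex if $N_\ell=0$. A $P$-divisor $W$ on $\Gamma(F)$ is a choice of an integer $i_\ell$ for every leaf $\ell$ ($i_\ell-1$ is the multiplicity of $W$ at $\ell$); the result is denoted $\Gamma(F,W)$. For vertices $x,y$ let $\ell_{xy}$ be the product of all weights adjacent to, but not on, the path from $x$ to $y$ (so for a node $v$, $\ell_{vv}$ is the product of all weights at $v$). For a node $v$ put $N_v=\sum_{\ell\text{ leaf}}N_\ell\,\ell_{v\ell}$ and $\nu_v=\sum_{w\text{ node}}(2-\delta_w)\ell_{vw}+\sum_{\ell\text{ leaf}}i_\ell\,\ell_{v\ell}$. SPLICING. For a node $v$ and an edge $e$ at $v$ let $\Gamma_{ve}$ be the component of $\Gamma\setminus\{v\}$ in the direction of $e$; for a vertex $x$ of $\Gamma_{ve}$ let $\ell_{v,e,x}$ be the product of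 the weights at nodes of $\Gamma_{ve}$ that are adjacent to, but not on, the path from $v$ to $x$. Put $M_{ve}=\sum_{\ell}N_\ell\,\ell_{v,e,\ell}$ and $i_{ve}=\sum_{w}(2-\delta_w)\ell_{v,e,w}+\sum_{\ell}i_\ell\,\ell_{v,e,\ell}$, with $w$ running over nodes and $\ell$ over leaves of $\Gamma_{ve}$. Splicing $\Gamma(F,W)$ along a special edge $e$ joining $v_L$ and $v_R$ means cutting $e$: this gives two diagrams $\Gamma_L\ni v_L$ and $\Gamma_R\ni v_R$, which keep all their weights and leaf decorations; in $\Gamma_L$ the edge $e$ now joins $v_L$ to a new leaf, with weight $d_{v_Le}$ at $v_L$, and the new leaf has decorations $(N,i)=(M_{v_Le},i_{v_Le})$; symmetrically $\Gamma_R$ gets a new leaf attached to $v_R$ with weight $d_{v_Re}$ and decorations $(M_{v_Re},i_{v_Re})$. The decorations so obtained define $F_L,W_L,F_R,W_R$. ZETA FUNCTION. If $i_\ell\ne 0$ for every boundary vertex $\ell$ (i.e. $(N_\ell,i_\ell)\neq(0,0)$ for all leaves), the topological zeta function of $\Gamma=\Gamma(F,W)$ is $$Z(\Gamma;s)=\sum_{v\text{ node}}\frac{1}{\nu_v+sN_v}\Big(2-\delta_v+\sum_{\ell}\frac{d_{v\ell}}{i_\ell+sN_\ell}\Big)+\sum_{e\text{ special}}\frac{q_e}{(\nu_v+sN_v)(\nu_w+sN_w)},$$ where $\ell$ runs over the leaves adjacent to $v$, $d_{v\ell}$ is the weight at $v$ of the edge to $\ell$, and $v,w$ are the end nodes of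 $e$. The contribution of a node $v$ in $Z(\Gamma;s)$ is the sum of the term of the first sum indexed by $v$ and the terms of the second sum indexed by special edges incident to $v$; its contribution to the residue at $-\nu_v/N_v$ is the residue there of this contribution. *)

(* Defs.v *)
From HB Require Import structures.
From mathcomp Require Import all_boot all_order all_algebra.

Set Implicit Arguments.
Unset Strict Implicit.
Unset Printing Implicit Defensive.

Import GRing.Theory.
Local Open Scope ring_scope.

(* The field Q(s).  All poles considered below are rational numbers. *)
Notation ratfun := {fraction {poly rat}}.

Notation "x %:F" := (@FracField.tofrac _ x) : ring_scope.

Definition svar : ratfun := ('X : {poly rat})%:F.

Definition regular_at (f : ratfun) (a : rat) : Prop :=
  exists p q : {poly rat}, q.[a] != 0 /\ f = p%:F / q%:F.

Definition has_pole (f : ratfun) (a : rat) (k : nat) : Prop :=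
  (0 < k)%N /\
  exists p q : {poly rat},
    [/\ p.[a] != 0, q.[a] != 0 & f = p%:F / (q * ('X - a%:P) ^+ k)%:F].

(* r is the coefficient of (s - a)^-1 in the Laurent expansion of f at a; the
   index of the principal part always reaches k = 1, so r is determined. *)
Definition has_residue (f : ratfun) (a r : rat) : Prop :=
  exists (n : nat) (c : nat -> rat) (g : ratfun),
    [/\ regular_at g a,
        f = \sum_(1 <= k < n.+2) (c k)%:P%:F / ('X - a%:P)%:F ^+ k + g
      & c 1%N = r].

(* An edge at v is represented by its other end w.  The raw data are total
   functions; only the following values are meaningful: wt v w for v a node
   and w adjacent to v (the weight d_{ve}), and mult l, idx l for l a leaf
   (the decorations N_l and i_l). *)
Record diagram := Diagram {
  vertex :> finType;
  adj : rel vertex;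
  wt : vertex -> vertex -> nat;
  mult : vertex -> nat;
  idx : vertex -> int
}.

Section Diagram.
Variable G : diagram.
Implicit Types v w x y z l u : G.

Definition valency v : nat := #|[set w | adj v w]|.
Definition leaf v : bool := valency v == 1%N.
Definition node v : bool := (3 <= valency v)%N.
Definition special v w : bool := [&& adj v w, node v & node w].
Definition boundary l : bool := leaf l && (mult l == 0%N).

Definition edge_det v w : int :=
  (wt v w * wt w v)%N%:Z
  - ((\prod_(u | adj v u && (u != w)) wt v u)
     * (\prod_(u | adj w u && (u != v)) wt w u))%N%:Z.

Definition is_tree : Prop :=
  [/\ symmetric (@adj G), irreflexive (@adj G),
      forall x y, connect (@adj G) x y
    & forall p : seq G, ucycle (@adj G) p -> (size p <= 2)%N].

Definition splice_diagram : Prop :=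
  [/\ is_tree,
      forall v, leaf v || node v,
      forall v w, node v -> adj v w -> (1 <= wt v w)%N,
      forall v w w', node v -> adj v w -> adj v w' -> w != w' ->
        coprime (wt v w) (wt v w')
    & forall v w, special v w -> 0 < edge_det v w]
  /\ (exists2 l, leaf l & (0 < mult l)%N).

(* z lies on the (in a tree: unique) simple path from x to y; such a path has
   fewer than #|G| edges. *)
Definition on_path x y z : bool :=
  [exists n : 'I_#|G|, exists p : n.-tuple G,
    [&& path (@adj G) x p, last x p == y, uniq (x :: p) & z \in x :: p]].

(* Only nodes carry weights.  In a tree, an edge zw with z on a path is on that
   path exactly when w is. *)
Definition ell x y : nat :=
  (\prod_(z | node z && on_path x y z)
     \prod_(w | adj z w && ~~ on_path x y w) wt z w)%N.

Definition Nv v : nat := (\sum_(l | leaf l) mult l * ell v l)%N.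

Definition nuv v : int :=
  \sum_(w | node w) (2 - (valency w)%:Z) * (ell v w)%:Z
  + \sum_(l | leaf l) idx l * (ell v l)%:Z.

(* Vertices of the component of G \ {v} containing the neighbour u of v. *)
Definition branch v u : {set G} :=
  [set x | connect [rel a b : G | [&& adj a b, a != v & b != v]] u x].

(* ell_{v,e,x}, for e = vu. *)
Definition ell_br v u x : nat :=
  (\prod_(z | [&& z \in branch v u, node z & on_path v x z])
     \prod_(w | adj z w && ~~ on_path v x w) wt z w)%N.

(* M_{ve} and i_{ve}, for e = vu. *)
Definition mult_br v u : nat :=
  (\sum_(l | (l \in branch v u) && leaf l) mult l * ell_br v u l)%N.

Definition idx_br v u : int :=
  \sum_(w | (w \in branch v u) && node w)
     (2 - (valency w)%:Z) * (ell_br v u w)%:Z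
  + \sum_(l | (l \in branch v u) && leaf l) idx l * (ell_br v u l)%:Z.

Definition zeta_defined : Prop := forall l, boundary l -> idx l != 0.

Definition lin (i : int) (N : nat) : ratfun := i%:~R + svar * N%:R.

Definition node_term v : ratfun :=
  1 / lin (nuv v) (Nv v)
  * (2 - (valency v)%:R
     + \sum_(l | leaf l && adj v l) (wt v l)%:R / lin (idx l) (mult l)).

Definition edge_term v w : ratfun :=
  (edge_det v w)%:~R / (lin (nuv v) (Nv v) * lin (nuv w) (Nv w)).

(* edge_term is symmetric; comparing ranks counts each special edge once. *)
Definition zeta : ratfun :=
  \sum_(v | node v) node_term v
  + \sum_v \sum_(w | special v w && (enum_rank v < enum_rank w)%N)
      edge_term v w.

Definition contribution v : ratfun :=
  node_term v + \sum_(w | special v w) edge_term v w.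

(* Vertices on the side of v after cutting the edge vw. *)
Definition cut_side v w : {set G} :=
  [set x | connect [rel a b : G |
             [&& adj a b, (a, b) != (v, w) & (a, b) != (w, v)]] v x].

Lemma cut_side_refl v w : v \in cut_side v w.
Proof. by rewrite inE connect0. Qed.

(* The half containing v of the splicing along the edge vw; None is the new
   leaf, attached to v. *)
Definition splice v w : diagram :=
  let T : finType := option {x : G | x \in cut_side v w} in
  @Diagram T
    (fun a b : T => match a, b with
       | Some x, Some y => adj (val x) (val y)
       | Some x, None | None, Some x => val x == v
       | None, None => false
     end)
    (fun a b : T => match a, b with
       | Some x, Some y => wt (val x) (val y)
       | Some x, None => wt (val x) w
       | None, _ => 1%N
     end)
    (fun a : T => if a is Some x then mult (val x) else mult_br v w)
    (fun a : T => if a is Some x then idx (val x) else idx_br v w).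

Definition splice_root v w : splice v w :=
  Some (exist _ v (cut_side_refl v w)).

End Diagram.

Arguments is_tree : clear implicits.
Arguments splice_diagram : clear implicits.
Arguments zeta_defined : clear implicits.
Arguments zeta : clear implicits.

Lemma on_pathP (G : diagram) (x y z : G) :
  reflect (exists p : seq G,
             [/\ path (@adj G) x p, last x p = y, uniq (x :: p) & z \in x :: p])
          (on_path x y z).
Proof.
apply: (iffP existsP) => [[n /existsP[p /and4P[h1 /eqP h2 h3 h4]]]|].
  by exists p; split.
move=> [p [h1 h2 h3 h4]].
have hs : (size p < #|G|)%N.
  by move/card_uniqP: h3 => /= <-; exact: max_card.
exists (Ordinal hs); apply/existsP; exists (in_tuple p).
by apply/and4P; split=> //; apply/eqP.
Qed.

Lemma regular_atB (f g : ratfun) (a : rat) :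
  regular_at f a -> regular_at g a -> regular_at (f - g) a.
Proof.
move=> [p [q [hq ->]]] [p' [q' [hq' ->]]].
have nz (u : {poly rat}) : u.[a] != 0 -> u%:F != 0.
  by apply: contraNneq => /eqP; rewrite tofrac_eq0 => /eqP->; rewrite horner0.
exists (p * q' - p' * q), (q * q'); split; first by rewrite hornerM mulf_neq0.
by rewrite tofracB !tofracM -mulNr addf_div ?nz // mulNr.
Qed.

Lemma clear_denom (K : fieldType) (t P Q : K) (c : nat -> K) (n : nat) :
  t != 0 -> Q != 0 -> \sum_(1 <= k < n.+1) c k / t ^+ k = P / Q ->
  Q * (\sum_(1 <= k < n.+1) c k * t ^+ (n - k)) = t ^+ n * P.
Proof.
move=> t0 Q0 h; rewrite -(divfK Q0 P) -h [RHS]mulrA [RHS]mulrC; congr (_ * _).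
rewrite big_distrr /=; apply: eq_big_nat => j /andP[_ hj].
rewrite mulrCA; congr (_ * _).
by rewrite -{2}(subnK (hj : (j <= n)%N)) exprD mulfK // expf_neq0.
Qed.

Lemma principal_part_eq0 (n : nat) (c : nat -> rat) (a : rat) :
  regular_at (\sum_(1 <= k < n.+1) (c k)%:P%:F / ('X - a%:P)%:F ^+ k) a ->
  forall k, (1 <= k <= n)%N -> c k = 0.
Proof.
elim: n => [|n IHn] hreg k; first by case: k.
have t0 : (('X - a%:P)%:F : ratfun) != 0 by rewrite tofrac_eq0 polyXsubC_eq0.
have cn0 : c n.+1 = 0.
  case: hreg => p [q [hq hE]].
  have q0 : (q%:F : ratfun) != 0.
    rewrite tofrac_eq0; apply: contraNneq hq => ->; by rewrite horner0.
  pose S := \sum_(1 <= k < n.+2) (c k)%:P * ('X - a%:P) ^+ (n.+1 - k).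
  have hS : q * S = ('X - a%:P) ^+ n.+1 * p.
    apply/eqP; rewrite -tofrac_eq !tofracM tofracXn; apply/eqP.
    rewrite -(clear_denom t0 q0 hE); congr (_ * _).
    rewrite /S (rmorph_sum (@FracField.tofrac _)).
    by apply: eq_bigr => j _; rewrite -tofracXn -tofracM.
  have := congr1 (horner^~ a) hS.
  rewrite /= !hornerM !horner_exp !hornerE subrr expr0n /= mul0r.
  move/eqP; rewrite mulf_eq0 (negPf hq) /= horner_sum big_nat_recr //=.
  rewrite big_nat big1 => [|j /andP[_ hj]].
    by rewrite subnn expr0 mulr1 hornerC add0r => /eqP.
  by rewrite hornerM horner_exp !hornerE subrr expr0n subn_eq0 leqNgt hj mulr0.
move=> /andP[k1]; rewrite leq_eqVlt => /orP[/eqP-> //|kn].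
apply: IHn; last by rewrite k1.
by move: hreg; rewrite big_nat_recr //= cn0 polyC0 tofrac0 mul0r addr0.
Qed.

Lemma sub_principal_part (K : fieldType) (t g g' : K) (c c' : nat -> K)
    (n n' : nat) :
  \sum_(1 <= k < n.+2) c k / t ^+ k + g
    = \sum_(1 <= k < n'.+2) c' k / t ^+ k + g' ->
  \sum_(1 <= k < (n + n').+2)
     ((if (k < n.+2)%N then c k else 0) - (if (k < n'.+2)%N then c' k else 0))
       / t ^+ k = g' - g.
Proof.
move=> h.
have pad m (b : nat -> K) : (m <= n + n')%N ->
  \sum_(1 <= k < (n + n').+2) (if (k < m.+2)%N then b k else 0) / t ^+ k
  = \sum_(1 <= k < m.+2) b k / t ^+ k.
  move=> hm; rewrite (big_cat_nat (n := m.+2)) //=.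
  rewrite [X in _ + X]big_nat [X in _ + X]big1 => [|k /andP[hk _]].
    by rewrite addr0; apply: eq_big_nat => k /andP[_ ->].
  by rewrite ltnNge hk /= mul0r.
under eq_bigr do rewrite mulrBl.
rewrite sumrB !pad ?leq_addr ?leq_addl //.
by apply/eqP; rewrite subr_eq addrAC eq_sym subr_eq addrC -h addrC.
Qed.

Lemma has_residue_unique (f : ratfun) (a r r' : rat) :
  has_residue f a r -> has_residue f a r' -> r = r'.
Proof.
move=> [n [c [g [hg hf <-]]]] [n' [c' [g' [hg' hf' <-]]]].
have := regular_atB hg' hg.
rewrite -(sub_principal_part (etrans (esym hf) hf')).
pose b k := (if (k < n.+2)%N then c k else 0)
            - (if (k < n'.+2)%N then c' k else 0).
under eq_bigr => k _.
  rewrite (_ : _ - _ = (b k)%:P%:F).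
    over.
  by rewrite /b polyCB tofracB; do 2 case: ifP => _; rewrite ?polyC0 ?tofrac0.
move=> /principal_part_eq0 /(_ 1%N isT) /eqP.
by rewrite /b /= subr_eq0 => /eqP.
Qed.

(* Main.v *)
Require Import Defs.
From mathcomp Require Import all_boot all_order all_algebra.
From mathcomp Require Import ring.

(* Write X = i + sM and X' = i' + sM' for the two new leaves, d, d' for the
   weights at vL, vR of the cut edge, and D, D' for the products of the other
   weights there.  A path between the two sides runs through the cut edge, so
   splicing preserves N_v and nu_v at every node, and the cut edge has end
   factors Y = d X' + D X and Y' = d' X + D' X' with q = d d' - D D'.  Then
     q / (Y Y') = d / (Y X) + d' / (Y' X') - 1 / (X X')
                = d / (Y X) - D' / (X Y').
   The first form is (1); by the second, splicing changes the contribution of vL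
   by - D' / (X Y').  If X does not vanish at the root a of Y, then neither does
   Y', because q <> 0, and this term is regular at a.  If X vanishes at a, so do
   X' and Y'; all coefficients of (s - a)^-2 in the zeta functions are
   nonnegative, and those of q / (Y Y') and d / (Y X) are positive, so Z and
   both contributions have a pole of order 2. *)

Set Implicit Arguments.
Unset Strict Implicit.
Unset Printing Implicit Defensive.

Import Order.TTheory GRing.Theory Num.Theory.
Local Open Scope ring_scope.

(** * Trees *)

Section Tree.
Variable G : diagram.
Hypothesis hT : is_tree G.
Implicit Types x y z v w a b : G.

Lemma adjC : symmetric (@adj G). Proof. by case: hT. Qed.

Lemma adjxx : irreflexive (@adj G). Proof. by case: hT. Qed.

Lemma neighbour_unique x a b p :
  adj x a -> adj x b -> path (@adj G) a p -> last a p = b -> x \notin a :: p ->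
  a = b.
Proof.
move=> xa xb ap lp; case/shortenP: ap lp => q aq uq sqp lp xap; subst b.
have xaq : x \notin a :: q.
  apply: contra xap; rewrite !inE => /orP[->//|/sqp->]; exact: orbT.
have [_ _ _ /(_ (x :: a :: q))] := hT; case: q => // c q in aq uq sqp xb xaq *.
suff: ucycle (@adj G) [:: x, a, c & q] by move=> h /(_ h).
rewrite /ucycle cons_uniq xaq uq andbT.
by rewrite -[cycle _ _]/(adj x a && path (@adj G) a (rcons (c :: q) x))
   rcons_path xa aq adjC xb.
Qed.

Lemma simple_path_unique x p q :
  path (@adj G) x p -> path (@adj G) x q -> uniq (x :: p) -> uniq (x :: q) ->
  last x p = last x q -> p = q.
Proof.
elim: p x q => [|a p IHp] x [|b q] //=.
- by move=> _ _ _ /andP[xq _] h; rewrite h mem_last in xq.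
- by move=> _ _ /andP[xp _] _ h; rewrite -h mem_last in xp.
move=> /andP[xa ap] /andP[xb bq] /andP[xap up] /andP[xbq uq] epq.
have ab : a = b.
  (* This walk follows [p] from [a] to the common end and returns along [q] to [b], never meeting
     [x]. *)
  apply: (neighbour_unique (x := x) (p := p ++ rev (belast b q))) => //.
  - rewrite cat_path ap epq rev_path.
    by rewrite (eq_path (e' := @adj G)) // => u u'; rewrite adjC.
  - by rewrite last_cat epq; case: (q) => //= c r; rewrite rev_cons last_rcons.
  rewrite -cat_cons mem_cat negb_or xap mem_rev.
  by apply: contra xbq => /mem_belast.
by rewrite -ab in bq uq epq *; rewrite (IHp a q).
Qed.

Lemma on_pathE x y z p :
  path (@adj G) x p -> last x p = y -> uniq (x :: p) ->
  on_path x y z = (z \in x :: p).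
Proof.
move=> xp lp up; apply/on_pathP/idP => [[q [xq lq uq]]|zp]; last by exists p.
by rewrite (simple_path_unique xp xq up uq) // lp lq.
Qed.

Lemma on_path_refl x z : on_path x x z = (z == x).
Proof. by rewrite (@on_pathE x x z [::]) ?inE. Qed.

Lemma on_path_start x y : on_path x y x.
Proof.
have [_ _ /(_ x y) /connectP[p /shortenP[q xq uq _] ->] _] := hT.
by apply/on_pathP; exists q; rewrite mem_head.
Qed.

Lemma on_path_end x y : on_path x y y.
Proof.
have [_ _ /(_ x y) /connectP[p /shortenP[q xq uq _] ->] _] := hT.
by apply/on_pathP; exists q; rewrite mem_last.
Qed.

(** * The two sides of a cut edge *)

Section Cut.
Variables v w : G.
Hypothesis vw : adj v w.

Lemma cut_adj_sym :
  symmetric [rel a b : G | [&& adj a b, (a, b) != (v, w) & (a, b) != (w, v)]].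
Proof.
move=> a b /=; rewrite adjC; congr (_ && _); rewrite andbC !xpair_eqE.
by rewrite [(b == w) && _]andbC [(b == v) && _]andbC.
Qed.

(** By uniqueness, a simple path from [v] to [w] is the single edge [vw], which has been removed. *)
Lemma cut_notin : w \notin cut_side v w.
Proof.
rewrite inE; apply/connectP => -[p /shortenP[q vq uq _] lq].
have vq' : path (@adj G) v q by apply: sub_path vq => a b /= /and3P[].
have hq := simple_path_unique vq' (q := [:: w]).
move: vq; rewrite {}hq /= ?vw ?inE //= ?eqxx ?andbF // andbT.
by apply: contraTneq vw => ->; rewrite adjxx.
Qed.

Lemma cut_sideC : cut_side w v = ~: cut_side v w.
Proof.
have e := sym_connect_sym cut_adj_sym.
have e' x : (x \in cut_side w v) = connect [rel a b : G |
    [&& adj a b, (a, b) != (v, w) & (a, b) != (w, v)]] w x.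
  by rewrite inE; apply: eq_connect => a b /=; congr (_ && _); rewrite andbC.
apply/setP => x; rewrite [RHS]inE; apply/idP/idP => [|xv].
  rewrite e' => wx; apply: contra cut_notin; rewrite !inE => /connect_trans-> //.
  by rewrite e.
have [_ _ /(_ v x) /connectP[p vp lp] _] := hT.
(* Lying on one of the two sides is preserved along any walk of [G]: a step through the cut edge
   lands at one of its ends, and any other step stays on its side. *)
suff H (y : G) q :
    path (@adj G) y q -> (y \in cut_side v w) || (y \in cut_side w v) ->
    (last y q \in cut_side v w) || (last y q \in cut_side w v).
  by have := H v p vp; rewrite cut_side_refl -lp (negPf xv) => /(_ isT).
elim: q y => //= z q IHq y /andP[yz zq] hy; apply: IHq => //.
have [[_ ->]|n1] := eqVneq (y, z) (v, w); first by rewrite cut_side_refl orbT.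
have [[_ ->]|n2] := eqVneq (y, z) (w, v); first by rewrite cut_side_refl.
have c : connect [rel a b : G |
    [&& adj a b, (a, b) != (v, w) & (a, b) != (w, v)]] y z.
  by apply: connect1; rewrite /= yz n1 n2.
case/orP: hy; last by rewrite !e' => /connect_trans->; rewrite ?orbT.
by rewrite inE => /connect_trans h; rewrite inE h.
Qed.

Lemma cut_adj x y :
  x \in cut_side v w -> y \notin cut_side v w -> adj x y -> x = v /\ y = w.
Proof.
move=> xL yR xy; have [[-> ->//]|n1] := eqVneq (x, y) (v, w).
have [[ey]|n2] := eqVneq (x, y) (w, v).
  by rewrite ey (negPf cut_notin) in xL.
case/negP: yR; move: xL; rewrite !inE => /connect_trans -> //.
by apply: connect1; rewrite /= xy n1 n2.
Qed.

Lemma cut_path x y : x \in cut_side v w -> y \in cut_side v w ->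
  exists p, [/\ path (@adj G) x p, last x p = y, uniq (x :: p)
              & {subset x :: p <= cut_side v w}].
Proof.
move=> xL yL; have e := sym_connect_sym cut_adj_sym.
have /connectP[p /shortenP[q xq uq _] ->] : connect [rel a b : G |
    [&& adj a b, (a, b) != (v, w) & (a, b) != (w, v)]] x y.
  by move: xL yL; rewrite !inE e => /connect_trans; apply.
exists q; split=> // [|z /(path_connect xq) xz].
  by apply: sub_path xq => a b /= /and3P[].
by move: xL; rewrite !inE => /connect_trans->.
Qed.

(** Sides are convex: they contain a simple path between any two of their vertices, and it is the
    only one in [G]. *)
Lemma on_path_in_cut x y z :
  x \in cut_side v w -> y \in cut_side v w -> on_path x y z ->
  z \in cut_side v w.
Proof.
move=> xL yL; have [p [xp lp up sp]] := cut_path xL yL.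
by rewrite (on_pathE _ xp lp up) => /sp.
Qed.

End Cut.

(** A walk from [w] that avoids the edge [vw] stays on the side of [w], which misses [v]; so
    deleting only the edge or the whole vertex [v] makes no difference to it. *)
Lemma branch_cut v w : adj v w -> branch v w = cut_side w v.
Proof.
move=> vw; have wv : adj w v by rewrite adjC.
apply/setP => x; rewrite !inE; apply/idP/idP => [|wx].
  apply: connect_sub => a b /= /and3P[ab av bv]; apply: connect1.
  by rewrite /= ab !xpair_eqE (negPf av) (negPf bv) !andbF.
case/connectP: (wx) => p wp ->; apply/connectP; exists p => //.
apply: (sub_in_path (P := cut_side w v)) (wp) => [a b aR bR /= /and3P[-> _ _]|].
  have nv c : c \in cut_side w v -> c != v.
    by apply: contraTneq => ->; apply: cut_notin.
  by rewrite !nv.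
apply/allP => z /(path_connect wp) wz.
rewrite -[X in is_true X]/(z \in cut_side w v).
by rewrite inE.
Qed.

End Tree.

(** * Splicing as an induced subgraph *)

(* The factor of [ell x y] coming from the vertices in [S]; when [S] is a branch
   at [x], this is [ell_br]. *)
Definition path_weight (G : diagram) (x y : G) (S : {set G}) : nat :=
  (\prod_(z | [&& z \in S, node z & on_path x y z])
     \prod_(u | adj z u && ~~ on_path x y u) wt z u)%N.

(* The inclusion of a spliced half as an induced subgraph of [G]: the new leaf
   goes to the far end of the cut edge. *)
Definition unsplice (G : diagram) (v w : G) (a : splice v w) : G :=
  if a is Some x then val x else w.

Section Splice.
Variable G : diagram.
Hypothesis hT : is_tree G.
Variables v w : G.
Hypothesis vw : adj v w.
Implicit Types (x y z u : G) (a b c : splice v w).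

Let wNL : (w \in cut_side v w) = false.
Proof. exact/negbTE/cut_notin. Qed.

Let vL : v \in cut_side v w := cut_side_refl v w.

Lemma unsplice_inj : injective (@unsplice G v w).
Proof.
move=> [x|] [y|] //=; first by move/val_inj->.
  by move=> h; have : sval x \in cut_side v w := valP x; rewrite h wNL.
by move=> h; have : sval y \in cut_side v w := valP y; rewrite -h wNL.
Qed.

Lemma big_unsplice (R : Type) (i0 : R) (op : Monoid.com_law i0) (P : pred G)
    (F : G -> R) : (forall x, P x -> (x \in cut_side v w) || (x == w)) ->
  \big[op/i0]_(x | P x) F x =
  \big[op/i0]_(a : splice v w | P (unsplice a)) F (unsplice a).
Proof.
move=> hP; rewrite (reindex_onto (@unsplice G v w) (fun x => insub x)) /=.
  apply: eq_bigl => -[x|] /=; first by rewrite valK eqxx andbT.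
  by rewrite insubN ?wNL // eqxx andbT.
by move=> x /hP /orP[xL|/eqP->]; [rewrite insubT | rewrite insubN ?wNL].
Qed.

(** The only neighbour of [w] on the near side is [v], so being [v], the condition for adjacency to
    the new leaf, amounts to adjacency to [w]. *)
Lemma adj_splice a b : adj a b = adj (unsplice a) (unsplice b).
Proof.
have h (x : {x | x \in cut_side v w}) : (val x == v) = adj (val x) w.
  apply/eqP/idP => [->//|xw]; apply: (proj1 (cut_adj hT vw _ _ xw)) => //.
    exact: valP.
  by rewrite wNL.
by case: a b => [x|] [y|] //=; rewrite ?h ?(adjxx hT) ?(adjC hT w).
Qed.

Lemma big_adj_splice (R : Type) (i0 : R) (op : Monoid.com_law i0)
    (x : {x | x \in cut_side v w}) (P : pred G) (F : G -> R) :
  \big[op/i0]_(u | adj (val x) u && P u) F u =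
  \big[op/i0]_(b : splice v w | adj (Some x : splice v w) b && P (unsplice b))
     F (unsplice b).
Proof.
rewrite big_unsplice => [|u /andP[xu _]].
  by apply: eq_bigl => b; rewrite adj_splice.
case: (boolP (u \in _)) => //= uL.
by rewrite (proj2 (cut_adj hT vw (valP x) uL xu)).
Qed.

Lemma valency_splice (x : {x | x \in cut_side v w}) :
  valency (Some x : splice v w) = valency (val x).
Proof.
rewrite /valency -!sum1dep_card.
under [RHS]eq_bigl do rewrite -[adj _ _]andbT.
by rewrite big_adj_splice; apply: eq_bigl => b; rewrite andbT.
Qed.

Lemma valency_new_leaf : valency (None : splice v w) = 1%N.
Proof.
rewrite /valency -(cards1 (splice_root v w)); congr #|pred_of_set _|.
apply/setP => a; rewrite !inE; case: a => [x|] //=.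
Qed.

Lemma node_splice a :
  node a = (unsplice a \in cut_side v w) && node (unsplice a).
Proof.
case: a => [x|]; rewrite /node ?valency_new_leaf ?wNL //.
by rewrite valency_splice (valP x).
Qed.

Lemma leaf_splice (x : {x | x \in cut_side v w}) :
  leaf (Some x : splice v w) = leaf (val x).
Proof. by rewrite /leaf valency_splice. Qed.

Lemma leaf_new_leaf : leaf (None : splice v w).
Proof. by rewrite /leaf valency_new_leaf. Qed.

Lemma big_node_splice (R : Type) (i0 : R) (op : Monoid.com_law i0)
    (F : G -> R) :
  \big[op/i0]_(a : splice v w | node a) F (unsplice a)
  = \big[op/i0]_(x | (x \in cut_side v w) && node x) F x.
Proof.
rewrite [RHS]big_unsplice => [|x /andP[-> _]//].
by apply: eq_bigl => a; rewrite node_splice.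
Qed.

Lemma big_leaf_splice (R : Type) (i0 : R) (op : Monoid.com_law i0)
    (F : splice v w -> R) (F' : G -> R) :
  (forall x : {x | x \in cut_side v w}, F (Some x) = F' (val x)) ->
  \big[op/i0]_(a : splice v w | leaf a) F a
  = op (F None) (\big[op/i0]_(x | (x \in cut_side v w) && leaf x) F' x).
Proof.
move=> hF; rewrite (bigD1 None) ?leaf_new_leaf //=; congr (op _ _).
rewrite [RHS]big_unsplice => [|x /andP[-> _]//].
apply: eq_big => [[x|]|[x|]] //=; rewrite ?andbF ?wNL //.
by rewrite andbT leaf_splice (valP x).
Qed.

(** Simple paths from [x] to [v] and from [w] to [y] lie on disjoint sides, so joining them by the
    cut edge gives a simple path. *)
Lemma on_path_cross x y z : x \in cut_side v w -> y \in cut_side w v ->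
  on_path x y z = on_path x v z || on_path w y z.
Proof.
move=> xL yR; have wv : adj w v by rewrite (adjC hT).
have [p [xp lp up sp]] := cut_path hT xL vL.
have [q [wq lq uq sq]] := cut_path hT (cut_side_refl w v) yR.
rewrite (on_pathE hT z xp lp up) (on_pathE hT z wq lq uq).
rewrite (@on_pathE _ hT _ _ _ (p ++ w :: q)).
- by rewrite -cat_cons mem_cat.
- by rewrite cat_path xp lp /= vw.
- by rewrite last_cat.
rewrite -cat_cons cat_uniq up uq andbT andTb.
apply/hasPn => u /sq; rewrite (cut_sideC hT vw) in_setC.
by apply: contra => /sp.
Qed.

Lemma on_path_near x y z : x \in cut_side v w -> y \in cut_side w v ->
  z \in cut_side v w -> on_path x y z = on_path x v z.
Proof.
move=> xL yR zL; rewrite on_path_cross //; apply/orb_idr => h.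
have wv : adj w v by rewrite (adjC hT).
have := on_path_in_cut hT (cut_side_refl w v) yR h.
by rewrite (cut_sideC hT vw) in_setC zL.
Qed.

Lemma on_path_far x y z : x \in cut_side v w -> y \in cut_side w v ->
  z \in cut_side w v -> on_path x y z = on_path w y z.
Proof.
move=> xL yR zR; rewrite on_path_cross //; apply/orb_idl => h.
have := on_path_in_cut hT xL vL h.
by move: zR; rewrite (cut_sideC hT vw) in_setC => /negbTE->.
Qed.

Lemma unsplice_on_path (x : {x | x \in cut_side v w}) b u :
  on_path (val x) (unsplice b) u -> (u \in cut_side v w) || (u == w).
Proof.
case: b => [y|] /= h; first by rewrite (on_path_in_cut hT (valP x) (valP y) h).
move: h; rewrite (on_path_cross _ (valP x) (cut_side_refl w v)).
rewrite (on_path_refl hT) => /orP[h|->]; last exact: orbT.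
by rewrite (on_path_in_cut hT (valP x) vL h).
Qed.

(** Paths of the half map to paths of [G]. Conversely, by convexity, the simple path of [G] between
    two images stays in the image and can be pulled back. *)
Lemma on_path_splice (x : {x | x \in cut_side v w}) b c :
  on_path (Some x : splice v w) b c
  = on_path (val x) (unsplice b) (unsplice c).
Proof.
have pathE p : path (@adj (splice v w)) (Some x) p
             = path (@adj G) (val x) (map (@unsplice G v w) p).
  by rewrite -[val x]/(unsplice (Some x)) path_map; apply: eq_path => a a' /=;
     exact: adj_splice.
apply/on_pathP/on_pathP => [[p [xp lp up cp]]|[q [xq lq uq cq]]].
  exists (map (@unsplice G v w) p).
  rewrite -pathE -[val x]/(unsplice (Some x)) last_map -map_cons.
  by rewrite (map_inj_uniq unsplice_inj) lp up map_f.
have [p def_q] : exists p, q = map (@unsplice G v w) p.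
  exists (map (fun u => insub u) q); rewrite -map_comp map_id_in // => u uq'.
  have /unsplice_on_path : on_path (val x) (unsplice b) u.
    by apply/on_pathP; exists q; rewrite inE uq' orbT.
  by move=> /orP[uL|/eqP->] /=; [rewrite insubT | rewrite insubN ?wNL].
exists p; move: xq lq uq cq; rewrite def_q -pathE.
rewrite -[val x]/(unsplice (Some x)) last_map -map_cons.
rewrite (map_inj_uniq unsplice_inj) mem_map; last exact: unsplice_inj.
by move=> ? /unsplice_inj ? ? ?.
Qed.

(** The nodes of the half are the nodes of the near side, and a weight towards the new leaf is the
    old weight towards [w]. *)
Lemma ell_splice (x : {x | x \in cut_side v w}) b :
  ell (Some x : splice v w) b
  = path_weight (val x) (unsplice b) (cut_side v w).
Proof.
rewrite /path_weight big_unsplice => [|z /and3P[-> _ _]//].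
apply: eq_big => [c|c]; first by rewrite node_splice on_path_splice andbA.
case: c => [z _|]; last by rewrite node_splice wNL.
rewrite big_adj_splice; apply: eq_big => [u|[u|] _] //.
by rewrite on_path_splice.
Qed.

Lemma ell_near x y : x \in cut_side v w -> y \in cut_side v w ->
  ell x y = path_weight x y (cut_side v w).
Proof.
move=> xL yL; apply: eq_bigl => z; rewrite andbCA; congr (_ && _).
by apply/esym/andb_idl; apply: on_path_in_cut.
Qed.

(** The first factor does not depend on [y]. This is why, seen from [x], the whole far side acts
    like one leaf at [w] decorated by [mult_br v w] and [idx_br v w]. *)
Lemma ell_cross x y : x \in cut_side v w -> y \in cut_side w v ->
  ell x y = (path_weight x w (cut_side v w) * ell_br v w y)%N.
Proof.
move=> xL yR; have wv : adj w v by rewrite (adjC hT).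
have wR := cut_side_refl w v.
have cL u : (u \in cut_side v w) = ~~ (u \in cut_side w v).
  by rewrite (cut_sideC hT vw) in_setC negbK.
rewrite /ell (bigID (mem (cut_side v w))) /=; congr (_ * _)%N.
  apply: eq_big => [z|z /andP[/andP[_ _] zL]].
    rewrite andbC andbA [RHS]andbA; apply: andb_id2l => /andP[zL _].
    by rewrite (on_path_near xL yR zL) (on_path_near xL wR zL).
  apply: eq_bigl => u; apply: andb_id2l => zu; congr (~~ _).
  have [uL|uL] := boolP (u \in cut_side v w).
    by rewrite (on_path_near xL yR uL) (on_path_near xL wR uL).
  (* Here [zu] is the cut edge, so [u = w], which lies on both paths. *)
  rewrite (proj2 (cut_adj hT vw zL uL zu)).
  by rewrite (on_path_far xL yR wR) (on_path_start hT) (on_path_end hT).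
rewrite /ell_br (branch_cut hT vw); apply: eq_big => [z|z /andP[_]].
  rewrite cL negbK andbC andbA [RHS]andbA; apply: andb_id2l => /andP[zR _].
  by rewrite (on_path_far xL yR zR) (on_path_far vL yR zR).
rewrite cL negbK => zR; apply: eq_bigl => u; apply: andb_id2l => zu.
congr (~~ _); have [uR|uR] := boolP (u \in cut_side w v).
  by rewrite (on_path_far xL yR uR) (on_path_far vL yR uR).
rewrite (proj2 (cut_adj hT wv zR uR zu)).
by rewrite (on_path_near xL yR vL) (on_path_start hT) (on_path_end hT).
Qed.

End Splice.

(** * Multiplicities *)

Definition other_weights (G : diagram) (v w : G) : nat :=
  (\prod_(u | adj v u && (u != w)) wt v u)%N.

(** Extended by zero, the edge terms can be summed over all ordered pairs of nodes, and such sums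
    split along the cut by [big_cut]. *)
Definition link (G : diagram) (x y : G) : ratfun :=
  if adj x y then edge_term x y else 0.

Section Decorations.
Variable G : diagram.
Hypothesis hT : is_tree G.
Variables v w : G.
Hypothesis vw : adj v w.
Implicit Types (x y z u : G).

Let wv : adj w v. Proof. by rewrite (adjC hT). Qed.

Lemma on_path_step y z : y \in cut_side v w ->
  on_path w y z = (z == w) || on_path v y z.
Proof.
move=> yL; rewrite (on_path_cross hT wv z (cut_side_refl w v) yL).
by rewrite (on_path_refl hT).
Qed.

(** The path from [w] to [y] starts with the cut edge and the path from [v] does not; the weight
    [wt v w] is the only one whose status changes. *)
Lemma ell_root y : node v -> y \in cut_side v w ->
  ell v y = (wt v w * ell_br w v y)%N.
Proof.
move=> nv yL; have vL := cut_side_refl v w.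
have offw : ~~ on_path v y w.
  apply: contra (cut_notin hT vw); exact: on_path_in_cut.
rewrite (ell_near hT vL yL) /ell_br (branch_cut hT wv) /path_weight.
have eqP z : z \in cut_side v w -> on_path w y z = on_path v y z.
  move=> zL; rewrite (on_path_step _ yL).
  by case: eqP zL => // ->; rewrite (negPf (cut_notin hT vw)).
rewrite (bigD1 v) ?vL ?nv ?(on_path_start hT) //=.
rewrite [in RHS](bigD1 v) ?vL ?nv ?eqP ?(on_path_start hT) //= mulnA.
congr (_ * _)%N.
  rewrite (bigD1 w) /= ?vw //; congr (_ * _)%N.
  by apply: eq_bigl => u; rewrite (on_path_step _ yL) negb_or -andbA
    [_ && (u != w)]andbC.
apply: eq_big => [z|z /andP[/and3P[zL _ _] zv]].
  by case: (boolP (z \in _)) => //= zL; rewrite eqP.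
apply: eq_bigl => u; apply: andb_id2l => zu; congr (~~ _).
rewrite eqP //; apply: contraNT zv => uL.
by rewrite (proj1 (cut_adj hT vw zL uL zu)).
Qed.

Lemma path_weight_root : node v ->
  path_weight v w (cut_side v w) = other_weights v w.
Proof.
move=> nv; have on z : on_path v w z = (z == v) || (z == w).
  rewrite (on_path_cross hT vw _ (cut_side_refl v w) (cut_side_refl w v)).
  by rewrite !(on_path_refl hT).
rewrite /path_weight (big_pred1 v) => [|z].
  apply: eq_bigl => u; apply: andb_id2l => vu; rewrite on negb_or.
  by case: eqP vu => // ->; rewrite (adjxx hT).
rewrite on /=; case: (eqVneq z v) => [->|_]; first by rewrite cut_side_refl nv.
by case: eqP => [->|_]; [rewrite (negPf (cut_notin hT vw)) | rewrite !andbF].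
Qed.

Lemma big_cut (R : Type) (i0 : R) (op : Monoid.com_law i0) (P : pred G)
    (F : G -> R) :
  \big[op/i0]_(x | P x) F x
  = op (\big[op/i0]_(x | (x \in cut_side v w) && P x) F x)
       (\big[op/i0]_(x | (x \in cut_side w v) && P x) F x).
Proof.
rewrite (bigID (mem (cut_side v w))) /=.
congr (op _ _); apply: eq_bigl => x; rewrite andbC //.
by rewrite (cut_sideC hT vw) in_setC.
Qed.

Lemma mult_br_cut :
  mult_br v w = (\sum_(l | (l \in cut_side w v) && leaf l) mult l * ell_br v w l)%N.
Proof. by rewrite /mult_br (branch_cut hT vw). Qed.

Lemma idx_br_cut :
  idx_br v w = \sum_(x | (x \in cut_side w v) && node x)
                 (2 - (valency x)%:Z) * (ell_br v w x)%:Z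
             + \sum_(l | (l \in cut_side w v) && leaf l) idx l * (ell_br v w l)%:Z.
Proof. by rewrite /idx_br (branch_cut hT vw). Qed.

Lemma Nv_cut x : x \in cut_side v w ->
  Nv x = (\sum_(l | (l \in cut_side v w) && leaf l) mult l * ell x l
          + path_weight x w (cut_side v w) * mult_br v w)%N.
Proof.
move=> xL; rewrite /Nv big_cut mult_br_cut /= big_distrr /=; congr (_ + _)%N.
by apply: eq_bigr => l /andP[lR _]; rewrite (ell_cross hT vw) // mulnCA.
Qed.

Lemma nuv_cut x : x \in cut_side v w ->
  nuv x = \sum_(y | (y \in cut_side v w) && node y)
            (2 - (valency y)%:Z) * (ell x y)%:Z
        + \sum_(l | (l \in cut_side v w) && leaf l) idx l * (ell x l)%:Z
        + (path_weight x w (cut_side v w))%:Z * idx_br v w.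
Proof.
move=> xL; rewrite /nuv big_cut [X in _ + X = _]big_cut idx_br_cut mulrDr.
rewrite !big_distrr /= addrACA.
by congr (_ + (_ + _)); apply: eq_bigr => y /andP[yR _];
   rewrite (ell_cross hT vw) // PoszM mulrCA.
Qed.

Lemma Nv_root : node v ->
  Nv v = (wt v w * mult_br w v + other_weights v w * mult_br v w)%N.
Proof.
move=> nv; rewrite Nv_cut ?cut_side_refl // path_weight_root //; congr (_ + _)%N.
rewrite /mult_br (branch_cut hT wv) big_distrr /=.
by apply: eq_bigr => l /andP[lL _]; rewrite ell_root // mulnCA.
Qed.

Lemma nuv_root : node v ->
  nuv v = (wt v w)%:Z * idx_br w v + (other_weights v w)%:Z * idx_br v w.
Proof.
move=> nv; rewrite nuv_cut ?cut_side_refl // path_weight_root //; congr (_ + _).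
rewrite /idx_br (branch_cut hT wv) mulrDr !big_distrr /=.
by congr (_ + _); apply: eq_bigr => y /andP[yL _];
   rewrite ell_root // PoszM mulrCA.
Qed.

(** This is the relation [Y = d X' + D X]; exchanging [v] and [w] gives the one for [Y']. *)
Lemma lin_root : node v ->
  lin (nuv v) (Nv v) = (wt v w)%:R * lin (idx_br w v) (mult_br w v)
                     + (other_weights v w)%:R * lin (idx_br v w) (mult_br v w).
Proof.
move=> nv; rewrite /lin nuv_root // Nv_root // rmorphD !rmorphM /= !natrD !natrM.
by rewrite !mulrDr addrACA ![svar * (_ * _)]mulrCA.
Qed.

Lemma Nv_splice (x : {x | x \in cut_side v w}) :
  Nv (Some x : splice v w) = Nv (val x).
Proof.
have xL : val x \in _ := valP x; rewrite Nv_cut // /Nv.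
rewrite (big_leaf_splice hT vw _ (F' := fun l => mult l * ell (val x) l)%N) /=.
  by rewrite ell_splice // mulnC addnC.
by move=> l; rewrite ell_splice // (ell_near hT xL) // (valP l).
Qed.

Lemma nuv_splice (x : {x | x \in cut_side v w}) :
  nuv (Some x : splice v w) = nuv (val x).
Proof.
have xL : val x \in _ := valP x; rewrite nuv_cut // /nuv -addrA; congr (_ + _).
  rewrite -(big_node_splice hT vw); apply: eq_bigr => -[y|]; last first.
    by rewrite (node_splice hT vw) /= (negPf (cut_notin hT vw)).
  by rewrite valency_splice // ell_splice // (ell_near hT xL) // (valP y).
rewrite (big_leaf_splice hT vw _ (F' := fun l => idx l * (ell (val x) l)%:Z)) /=.
  by rewrite ell_splice // mulrC addrC.
by move=> l; rewrite ell_splice // (ell_near hT xL) // (valP l).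
Qed.

(** Only [v] sees the new leaf, which adds [d / (Y X)] to its term. *)
Lemma node_term_splice (x : {x | x \in cut_side v w}) : node w ->
  node_term (Some x : splice v w) = node_term (val x)
    + (if val x == v then (wt v w)%:R
         / (lin (nuv v) (Nv v) * lin (idx_br v w) (mult_br v w)) else 0).
Proof.
move=> nw; have xL : val x \in cut_side v w := valP x.
rewrite /node_term Nv_splice nuv_splice valency_splice // big_mkcondr /=.
rewrite (big_leaf_splice hT vw _ (F' := fun l => if adj (val x) l then
   (wt (val x) l)%:R / lin (idx l) (mult l) else 0)) //=.
rewrite -big_mkcondr /= [X in _ * (_ + (_ + X))](_ : _ =
   \sum_(l | leaf l && adj (val x) l) (wt (val x) l)%:R / lin (idx l) (mult l)).
  rewrite addrCA mulrDr [LHS]addrC; congr (_ + _).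
  case: eqP => [->|_]; last exact: mulr0.
  by rewrite div1r mulrCA invfM.
(* No leaf next to [x] is lost by the cut: a neighbour of [x] across it is [w], which is a node. *)
apply: eq_bigl => l; case xl: (adj (val x) l); rewrite ?andbF // !andbT.
apply/andb_idl => ll; apply: contraLR nw => lL.
rewrite -(proj2 (cut_adj hT vw xL lL xl)) /node.
by move: ll; rewrite /leaf => /eqP->.
Qed.

Lemma link_splice (x y : {x | x \in cut_side v w}) :
  link (Some x : splice v w) (Some y) = link (val x) (val y).
Proof.
have det (x1 x2 : {x | x \in cut_side v w}) :
    other_weights (Some x1 : splice v w) (Some x2) = other_weights (val x1) (val x2).
  rewrite /other_weights (big_adj_splice hT vw); apply: eq_big => [b|[u|] _] //.
  by rewrite -(inj_eq (unsplice_inj hT vw)).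
rewrite /link /edge_term /edge_det -!/(other_weights _ _) !det /=.
by rewrite !Nv_splice !nuv_splice.
Qed.

End Decorations.

(** * The splicing formula *)

(** The polynomial behind [lin], needed to evaluate at a point. *)
Definition linp (i : int) (N : nat) : {poly rat} := i%:~R%:P + N%:R%:P * 'X.

Lemma linE i N : lin i N = (linp i N)%:F.
Proof.
rewrite /lin /linp tofracD tofracM mulrC.
by rewrite (rmorph_int (@polyC rat)) (rmorph_nat (@polyC rat)) rmorph_int rmorph_nat.
Qed.

Lemma horner_linp i N a : (linp i N).[a] = i%:~R + N%:R * a.
Proof. by rewrite !hornerE. Qed.

Lemma lin_eq0 i N : lin i N = 0 -> i = 0 /\ N = 0%N.
Proof.
rewrite linE => /eqP; rewrite tofrac_eq0 => /eqP h.
have := congr1 (horner^~ 0) h; have := congr1 (horner^~ 1) h.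
rewrite /= !horner_linp !horner0 mulr0 addr0 mulr1 => h1 /eqP.
rewrite intr_eq0 => /eqP i0; split=> //.
by move/eqP: h1; rewrite i0 add0r pnatr_eq0 => /eqP.
Qed.

Lemma double_inj (K : fieldType) (f g : K) :
  2%:R != 0 :> K -> f + f = g + g -> f = g.
Proof. by move=> h2 h; apply: (mulIf h2); rewrite !mulr_natr !mulr2n. Qed.

Lemma ratfun2_neq0 : 2%:R != 0 :> ratfun.
Proof.
apply/eqP => h; have := @lin_eq0 (Posz 2) 0.
by rewrite /lin mulr0 addr0 -pmulrn h => /(_ erefl) [].
Qed.

Lemma edge_term_identity (K : fieldType) (d d' D D' q X X' Y Y' : K) :
  X != 0 -> X' != 0 -> Y != 0 -> Y' != 0 ->
  Y = d * X' + D * X -> Y' = d' * X + D' * X' -> q = d * d' - D * D' ->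
  q / (Y * Y') = d / (Y * X) + d' / (Y' * X') - 1 / (X * X').
Proof.
move=> X0 X0' Y0 Y0' eY eY' ->; move: Y0 Y0'; rewrite eY eY' => Y0 Y0'.
by field; rewrite X0 X0' Y0 Y0'.
Qed.

(** Here [s1], [s2] stand for the node sums and [l1], [l2] for the link sums of the two sides, [e]
    for the term of the cut edge, and [a], [b], [c] for the three terms into which it decomposes.
    All is doubled because ordered pairs count each edge twice. *)
Lemma double_sum (K : fieldType) (z z1 z2 s1 s2 l1 l2 e a b c : K) :
  2%:R != 0 :> K -> e = a + b - c ->
  z + z = s1 + s2 + (s1 + s2) + (l1 + e + (e + l2)) ->
  z1 + z1 = s1 + a + (s1 + a) + l1 -> z2 + z2 = s2 + b + (s2 + b) + l2 ->
  z = z1 + z2 - c.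
Proof.
move=> h2 -> hz h1 h2'; apply: (double_inj h2).
rewrite hz [RHS](_ : _ = (z1 + z1) + (z2 + z2) - c - c); last by ring.
by rewrite h1 h2'; ring.
Qed.

Lemma edge_termC (G : diagram) (x y : G) : edge_term x y = edge_term y x.
Proof.
rewrite /edge_term /edge_det [(wt x y * _)%N]mulnC.
by rewrite [(_ * \prod_(u | adj y u && _) _)%N]mulnC [lin _ _ * _]mulrC.
Qed.

Lemma sum_link (G : diagram) (x : G) : node x ->
  \sum_(y | node y) link x y = \sum_(y | special x y) edge_term x y.
Proof.
move=> nx; rewrite -big_mkcondr; apply: eq_bigl => y.
by rewrite /special nx andbC.
Qed.

(** Counting each special edge in both directions removes the comparison of ranks from [zeta], so
    that the sums can be compared between [G] and its halves. *)
Lemma zeta_double (G : diagram) : symmetric (@adj G) -> irreflexive (@adj G) ->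
  zeta G + zeta G = \sum_(x : G | node x) node_term x
    + \sum_(x : G | node x) node_term x
    + \sum_(x : G | node x) \sum_(y : G | node y) link x y.
Proof.
move=> sG iG; rewrite /zeta addrACA; congr (_ + _).
have sC (x y : G) : special x y = special y x.
  by rewrite /special sG; congr (_ && _); rewrite andbC.
(* With the summations exchanged in one copy, [x] collects there its special edges to vertices of
   lower rank, and in the other copy those to vertices of higher rank. *)
rewrite [X in X + _](exchange_big_dep xpredT) //= -big_split [RHS]big_mkcond /=.
apply: eq_bigr => x _; rewrite addrC.
case nx: (node x); last first.
  rewrite !big_pred0 ?addr0 // => y; first by rewrite /special nx !andbF.
  by rewrite /special nx !andbF.
rewrite (sum_link nx) [RHS](bigID (fun y => (enum_rank x < enum_rank y)%N)) /=.
congr (_ + _); apply: eq_big => [y|y _]; last exact: edge_termC.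
rewrite sC; apply: andb_id2l => xy; rewrite -leqNgt [RHS]leq_eqVlt.
case: eqP => // exy; have {}exy := enum_rank_inj (val_inj exy).
by rewrite exy /special iG in xy.
Qed.

(** * Zeta functions and contributions across the cut *)

Section Zeta.
Variable G : diagram.
Hypothesis hT : is_tree G.
Variables v w : G.
Hypothesis hvw : special v w.
Implicit Types (x y z u : G).

Let vw : adj v w. Proof. by case/and3P: hvw. Qed.
Let nv : node v. Proof. by case/and3P: hvw. Qed.
Let nw : node w. Proof. by case/and3P: hvw. Qed.
Let wv : adj w v. Proof. by rewrite (adjC hT). Qed.
Let vL := cut_side_refl v w.

Lemma sum_node_term_splice :
  \sum_(a : splice v w | node a) node_term a
  = \sum_(x | (x \in cut_side v w) && node x) node_term x
    + (wt v w)%:R / (lin (nuv v) (Nv v) * lin (idx_br v w) (mult_br v w)).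
Proof.
set c : ratfun := _ / _.
rewrite (eq_bigr (fun a => node_term (unsplice a)
   + (if unsplice a == v then c else 0))); last first.
  move=> [x|]; last by rewrite (node_splice hT vw) /= (negPf (cut_notin hT vw)).
  by rewrite (node_term_splice hT vw).
rewrite (big_node_splice hT vw _ (fun x => node_term x + if x == v then c else 0)).
rewrite big_split /=; congr (_ + _).
by rewrite -big_mkcondr /= (big_pred1 v) // => x /=;
   case: eqP => [->|]; rewrite ?andbF // vL nv.
Qed.

Lemma sum_link_splice :
  \sum_(a : splice v w | node a) \sum_(b : splice v w | node b) link a b
  = \sum_(x | (x \in cut_side v w) && node x)
      \sum_(y | (y \in cut_side v w) && node y) link x y.
Proof.
rewrite -(big_node_splice hT vw); apply: eq_bigr => -[x|]; last first.
  by rewrite (node_splice hT vw) /= (negPf (cut_notin hT vw)).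
move=> _; rewrite -(big_node_splice hT vw); apply: eq_bigr => -[y|]; last first.
  by rewrite (node_splice hT vw) /= (negPf (cut_notin hT vw)).
by move=> _; exact: link_splice.
Qed.

Lemma sum_link_cross_root :
  \sum_(y | (y \in cut_side w v) && node y) link v y = edge_term v w.
Proof.
rewrite (bigD1 w) ?cut_side_refl ?nw //= big1 => [|y /andP[/andP[yR _] yw]].
  by rewrite addr0 /link vw.
rewrite /link; case: ifP => // vy; case/eqP: yw.
by apply: (proj2 (cut_adj hT vw vL _ vy));
   rewrite (cut_sideC hT wv) in_setC negbK in yR *.
Qed.

(** The cut edge is the only edge between the two sides. *)
Lemma sum_link_cross :
  \sum_(x | (x \in cut_side v w) && node x)
    \sum_(y | (y \in cut_side w v) && node y) link x y = edge_term v w.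
Proof.
rewrite (bigD1 v) ?vL ?nv //= sum_link_cross_root big1 ?addr0 //.
move=> x /andP[/andP[xL _] xv]; apply: big1 => y /andP[yR _].
rewrite /link; case: ifP => // xy; case/eqP: xv.
by apply: (proj1 (cut_adj hT vw xL _ xy));
   rewrite (cut_sideC hT wv) in_setC negbK in yR *.
Qed.

Lemma contribution_cut :
  contribution v = node_term v
    + \sum_(y | (y \in cut_side v w) && node y) link v y + edge_term v w.
Proof.
rewrite /contribution -(sum_link nv) (big_cut hT vw) /= sum_link_cross_root.
exact: addrA.
Qed.

(** Compared with [contribution_cut], the term [q / (Y Y')] of the cut edge is replaced by the term
    [d / (Y X)] of the new leaf. *)
Lemma contribution_splice :
  contribution (splice_root v w) = node_term v
    + \sum_(y | (y \in cut_side v w) && node y) link v y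
    + (wt v w)%:R / (lin (nuv v) (Nv v) * lin (idx_br v w) (mult_br v w)).
Proof.
have nr : node (splice_root v w) by rewrite (node_splice hT vw) /= vL nv.
rewrite /contribution -(sum_link nr) node_term_splice //= eqxx addrAC.
congr (_ + _ + _); rewrite -(big_node_splice hT vw); apply: eq_bigr => -[y|].
  by move=> _; rewrite /splice_root link_splice.
by rewrite (node_splice hT vw) /= (negPf (cut_notin hT vw)).
Qed.

(** If the multiplicity of the new leaf is zero, it is a boundary vertex, and then its other
    decoration is nonzero by assumption. *)
Lemma lin_br_neq0 : zeta_defined (splice v w) ->
  lin (idx_br v w) (mult_br v w) != 0.
Proof.
move=> hZ; apply/eqP => /lin_eq0 [i0 M0].
have := hZ None; rewrite /boundary leaf_new_leaf /= M0 eqxx i0 eqxx.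
by move=> /(_ isT).
Qed.

Lemma edge_det_weights : (edge_det v w)%:~R =
  (wt v w)%:R * (wt w v)%:R - (other_weights v w)%:R * (other_weights w v)%:R :> ratfun.
Proof. by rewrite /edge_det rmorphB /= -!pmulrn !natrM. Qed.

Lemma zeta_splice_double :
  zeta (splice v w) + zeta (splice v w)
  = let S := \sum_(x | (x \in cut_side v w) && node x) node_term x
      + (wt v w)%:R / (lin (nuv v) (Nv v) * lin (idx_br v w) (mult_br v w)) in
    S + S + \sum_(x | (x \in cut_side v w) && node x)
              \sum_(y | (y \in cut_side v w) && node y) link x y.
Proof.
rewrite zeta_double ?sum_node_term_splice ?sum_link_splice //.
  by move=> a b; rewrite !(adj_splice hT vw) (adjC hT).
by move=> a; rewrite (adj_splice hT vw) (adjxx hT).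
Qed.
End Zeta.

Lemma zeta_splice (G : diagram) (v w : G) :
  is_tree G -> special v w ->
  lin (nuv v) (Nv v) != 0 -> lin (nuv w) (Nv w) != 0 ->
  lin (idx_br v w) (mult_br v w) != 0 -> lin (idx_br w v) (mult_br w v) != 0 ->
  zeta G = zeta (splice v w) + zeta (splice w v)
           - 1 / (lin (idx_br v w) (mult_br v w) * lin (idx_br w v) (mult_br w v)).
Proof.
move=> hT hvw; have /and3P[vw nv nw] := hvw.
have wv : adj w v by rewrite (adjC hT).
have hwv : special w v by rewrite /special wv nv nw.
move=> Y0 Y0' X0 X0'.
have edgeE : edge_term v w
    = (wt v w)%:R / (lin (nuv v) (Nv v) * lin (idx_br v w) (mult_br v w))
      + (wt w v)%:R / (lin (nuv w) (Nv w) * lin (idx_br w v) (mult_br w v))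
      - 1 / (lin (idx_br v w) (mult_br v w) * lin (idx_br w v) (mult_br w v)).
  exact: (edge_term_identity X0 X0' Y0 Y0' (lin_root hT vw nv)
            (lin_root hT wv nw) (edge_det_weights v w)).
apply: (double_sum ratfun2_neq0 edgeE _
  (zeta_splice_double hT hvw) (zeta_splice_double hT hwv)).
rewrite zeta_double; [|exact: adjC|exact: adjxx].
rewrite (big_cut hT vw _ (@node G) (@node_term G)); congr (_ + _).
(* The ordered pairs of nodes form four blocks: two inside a side, and two across the cut, each of
   which sums to the term of the cut edge. *)
rewrite (big_cut hT vw) /=; congr (_ + _).
  rewrite -(sum_link_cross hT hvw) -big_split.
  by apply: eq_bigr => x _; rewrite (big_cut hT vw).
rewrite (edge_termC v w) -(sum_link_cross hT hwv) -big_split.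
by apply: eq_bigr => x _; rewrite (big_cut hT vw).
Qed.

(** * Poles of order at most two *)

Section Local.
Variable a : rat.
Implicit Types (f g : ratfun) (p q : {poly rat}) (r : rat).

(** A relation, since evaluation on [ratfun] is partial; any fraction with denominator nonzero at
    [a] may serve, not only a reduced one. *)
Definition has_value f r : Prop :=
  exists p q, [/\ q.[a] != 0, f = p%:F / q%:F & p.[a] = r * q.[a]].

Definition uniformizer : ratfun := ('X - a%:P)%:F.

Lemma uniformizer_neq0 : uniformizer != 0.
Proof. by rewrite tofrac_eq0 polyXsubC_eq0. Qed.

Lemma tofrac_neq0 q : q.[a] != 0 -> q%:F != 0.
Proof.
by apply: contraNneq => /eqP; rewrite tofrac_eq0 => /eqP->; rewrite horner0.
Qed.

Lemma has_value_tofrac p : has_value p%:F p.[a].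
Proof. by exists p, 1; rewrite hornerC oner_neq0 tofrac1 divr1 mulr1. Qed.

Lemma has_value0 : has_value 0 0.
Proof. by have := has_value_tofrac 0; rewrite tofrac0 horner0. Qed.

Lemma has_valueD f g r s :
  has_value f r -> has_value g s -> has_value (f + g) (r + s).
Proof.
move=> [p [q [q0 -> ep]]] [p' [q' [q0' -> ep']]].
exists (p * q' + p' * q), (q * q'); split; first by rewrite hornerM mulf_neq0.
  by rewrite tofracD !tofracM addf_div ?tofrac_neq0.
by rewrite hornerD !hornerM ep ep'; ring.
Qed.

Lemma has_valueM f g r s :
  has_value f r -> has_value g s -> has_value (f * g) (r * s).
Proof.
move=> [p [q [q0 -> ep]]] [p' [q' [q0' -> ep']]].
exists (p * p'), (q * q'); split; first by rewrite hornerM mulf_neq0.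
  by rewrite !tofracM mulf_div.
by rewrite !hornerM ep ep' mulrACA.
Qed.

Lemma has_value_inv p : p.[a] != 0 -> has_value p%:F^-1 p.[a]^-1.
Proof.
by move=> p0; exists 1, p; split=> //; rewrite ?tofrac1 ?div1r // hornerC mulVf.
Qed.

Lemma has_value_nat n : has_value n%:R n%:R.
Proof.
by have := has_value_tofrac n%:R; rewrite rmorph_nat -(rmorph_nat (@polyC rat)) hornerC.
Qed.

Lemma has_value_int (i : int) : has_value i%:~R i%:~R.
Proof.
by have := has_value_tofrac i%:~R; rewrite rmorph_int -(rmorph_int (@polyC rat)) hornerC.
Qed.

Lemma has_value_uniformizer : has_value uniformizer 0.
Proof. by have := has_value_tofrac ('X - a%:P); rewrite !hornerE subrr. Qed.

Lemma has_value_regular f r : has_value f r -> regular_at f a.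
Proof. by move=> [p [q [q0 -> _]]]; exists p, q. Qed.

Lemma regular_has_value f : regular_at f a -> exists r, has_value f r.
Proof.
move=> [p [q [q0 ->]]]; exists (p.[a] / q.[a]), p, q.
by rewrite divfK.
Qed.

(** One step of Taylor expansion: the numerator of [f - r] vanishes at [a], hence is divisible by
    [s - a]. *)
Lemma has_value_expand f r : has_value f r ->
  exists2 g, regular_at g a & f = r%:P%:F + uniformizer * g.
Proof.
move=> [p [q [q0 -> ep]]]; have q1 := tofrac_neq0 q0.
have /factor_theorem [s es] : root (p - r%:P * q) a.
  by rewrite /root !hornerE ep subrr.
exists (s%:F / q%:F); first by exists s, q.
rewrite mulrA [uniformizer * _]mulrC -tofracM -es tofracB tofracM mulrBl mulfK //.
by rewrite addrC subrK.
Qed.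

Lemma has_residue_exists f r : has_value (f * uniformizer ^+ 2) r ->
  exists s, has_residue f a s.
Proof.
move=> /has_value_expand [g /regular_has_value [s /has_value_expand [h hr ->]] ef].
(* Two expansion steps write [f] times [(s - a)^2] as [r + (s - a) (s0 + (s - a) h)], where [s0] is
   the second value; so [r] is the coefficient of order two and [s0] the residue. *)
exists s, 1%N, (fun k => if k == 1%N then s else r), h; split=> //.
have t0 := uniformizer_neq0; rewrite -/uniformizer big_nat_recr //= big_nat1 /= expr1.
have t2 : uniformizer ^+ 2 != 0 by rewrite expf_neq0.
rewrite -[LHS](mulfK t2) ef expr2.
move: (r%:P%:F) (s%:P%:F) => R S; move: t0; move: uniformizer => t t0.
suff H (K : fieldType) (t' R' S' h' : K) : t' != 0 ->
    (R' + t' * (S' + t' * h')) / (t' * t') = S' / t' + R' / (t' * t') + h'.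
  exact: H.
by move=> ?; field.
Qed.

Lemma has_residue_addr f g r :
  regular_at g a -> has_residue f a r -> has_residue (f + g) a r.
Proof.
move=> /regular_has_value [s gs] [n [c [h [/regular_has_value [s' hs'] -> c1]]]].
exists n, c, (h + g); split=> //; last by rewrite addrA.
exact: has_value_regular (has_valueD hs' gs).
Qed.

(** This replaces the pole condition by one on a value, which is additive in [f]. *)
Lemma has_pole2P f :
  has_pole f a 2 <-> exists2 r, r != 0 & has_value (f * uniformizer ^+ 2) r.
Proof.
have t2 : uniformizer ^+ 2 != 0 by rewrite expf_neq0 ?uniformizer_neq0.
split=> [[_ [p [q [p0 q0 ->]]]]|[r r0 [p [q [q0 ef ep]]]]].
  exists (p.[a] / q.[a]); first by rewrite mulf_neq0 ?invr_neq0.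
  exists p, q; split; rewrite ?divfK //.
  by rewrite tofracM tofracXn -/uniformizer invfM [X in X * _]mulrA divfK.
split=> //; exists p, q; split=> //; first by rewrite ep mulf_neq0.
by rewrite tofracM tofracXn -/uniformizer invfM mulrA -ef mulfK.
Qed.

Lemma has_pole2_addr f g :
  regular_at g a -> has_pole f a 2 -> has_pole (f + g) a 2.
Proof.
move=> /regular_has_value [s gs]; rewrite !has_pole2P => -[r r0 hr].
exists r => //; rewrite mulrDl -[r]addr0; apply: has_valueD => //.
rewrite -[0](mulr0 s) -[0](mulr0 0); apply: has_valueM gs _.
by apply: has_valueM; apply: has_value_uniformizer.
Qed.

Definition pole_coef f r : Prop := has_value (f * uniformizer) r.

(** A linear factor that vanishes at [a] is [N (s - a)]; any other has a regular inverse. *)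
Lemma pole_coef_lin i N :
  pole_coef (lin i N)^-1 (if (linp i N).[a] == 0 then N%:R^-1 else 0).
Proof.
rewrite /pole_coef linE; case: eqP => [h|/eqP h]; last first.
  rewrite -[0](mulr0 (linp i N).[a]^-1); apply: has_valueM has_value_uniformizer.
  exact: has_value_inv.
have eN : linp i N = N%:R * ('X - a%:P).
  move: h; rewrite horner_linp => /eqP; rewrite addr_eq0 => /eqP ei.
  rewrite /linp ei mulrBr polyCN polyCM addrC.
  by rewrite (rmorph_nat (@polyC rat)).
rewrite eN tofracM -/uniformizer rmorph_nat invfM.
(* For [N = 0] the linear factor is zero, and both inverses are zero by convention. *)
case: N {h eN} => [|N]; first by rewrite !invr0 !mul0r; apply: has_value0.
rewrite mulrVK ?unitfE ?uniformizer_neq0 //.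
have := @has_value_inv N.+1%:R; rewrite rmorph_nat -(rmorph_nat (@polyC rat)) hornerC.
by apply; rewrite pnatr_eq0.
Qed.

Lemma lin_coef_ge0 i N : 0 <= (if (linp i N).[a] == 0 then N%:R^-1 else 0) :> rat.
Proof. by case: ifP => // _; rewrite invr_ge0 ler0n. Qed.

(** A pole of order at most two whose coefficient of [(s - a)^-2] has a sign: such coefficients
    cannot cancel in a sum, so one positive summand forces a double pole. *)
Definition nonneg_coef2 f : Prop :=
  exists2 r, 0 <= r & has_value (f * uniformizer ^+ 2) r.

Definition pos_coef2 f : Prop :=
  exists2 r, 0 < r & has_value (f * uniformizer ^+ 2) r.

Lemma nonneg_coef2D f g :
  nonneg_coef2 f -> nonneg_coef2 g -> nonneg_coef2 (f + g).
Proof.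
move=> [r r0 fr] [s s0 gs]; exists (r + s); first exact: addr_ge0.
by rewrite mulrDl; apply: has_valueD.
Qed.

Lemma pos_coef2D f g : pos_coef2 f -> nonneg_coef2 g -> pos_coef2 (f + g).
Proof.
move=> [r r0 fr] [s s0 gs]; exists (r + s); first exact: ltr_wpDr.
by rewrite mulrDl; apply: has_valueD.
Qed.

Lemma nonneg_coef2_sum (I : finType) (P : pred I) (F : I -> ratfun) :
  (forall i, P i -> nonneg_coef2 (F i)) -> nonneg_coef2 (\sum_(i | P i) F i).
Proof.
move=> hF; apply: big_ind => //; last exact: nonneg_coef2D.
by exists 0; rewrite // mul0r; apply: has_value0.
Qed.

Lemma pos_coef2_sum (I : finType) (P : pred I) (F : I -> ratfun) j :
  (forall i, P i -> nonneg_coef2 (F i)) -> P j -> pos_coef2 (F j) ->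
  pos_coef2 (\sum_(i | P i) F i).
Proof.
move=> hF Pj hj; rewrite (bigD1 j) //=; apply: pos_coef2D => //.
by apply: nonneg_coef2_sum => i /andP[/hF].
Qed.

Lemma pos_coef2_has_pole f : pos_coef2 f -> has_pole f a 2.
Proof. by move=> [r r0 fr]; apply/has_pole2P; exists r; rewrite // lt0r_neq0. Qed.

Lemma coef2_lin_lin f r i N j M : has_value f r ->
  has_value (f / (lin i N * lin j M) * uniformizer ^+ 2)
    (r * (if (linp i N).[a] == 0 then N%:R^-1 else 0)
       * (if (linp j M).[a] == 0 then M%:R^-1 else 0)).
Proof.
move=> fr; rewrite [X in has_value X _](_ : _ =
  f * ((lin i N)^-1 * uniformizer) * ((lin j M)^-1 * uniformizer)).
  by do 2![apply: has_valueM; last exact: pole_coef_lin].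
by rewrite invfM expr2 -!mulrA; do 2!congr (_ * _); rewrite mulrCA.
Qed.

Lemma nonneg_lin_lin f r i N j M : 0 <= r -> has_value f r ->
  nonneg_coef2 (f / (lin i N * lin j M)).
Proof.
move=> r0 fr; eexists; last exact: coef2_lin_lin fr.
by rewrite !mulr_ge0 ?lin_coef_ge0.
Qed.

Lemma pos_lin_lin f r i N j M : 0 < r -> has_value f r ->
  (0 < N)%N -> (0 < M)%N -> (linp i N).[a] = 0 -> (linp j M).[a] = 0 ->
  pos_coef2 (f / (lin i N * lin j M)).
Proof.
move=> r0 fr N0 M0 ei ej; eexists; last exact: coef2_lin_lin fr.
by rewrite ei ej eqxx !mulr_gt0 ?invr_gt0 ?ltr0n.
Qed.

Section Terms.
Variable G : diagram.
Implicit Types x y : G.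

(** The part with [2 - valency] has at most a simple pole, so its possibly negative sign does not
    matter; each leaf part has a natural number over two linear factors. *)
Lemma nonneg_node_term x : nonneg_coef2 (node_term x).
Proof.
rewrite /node_term mulrDr mulr_sumr; apply: nonneg_coef2D; last first.
  apply: nonneg_coef2_sum => l _; rewrite mulrCA div1r -invfM.
  exact: nonneg_lin_lin (has_value_nat _).
exists 0 => //; rewrite div1r expr2 mulrACA -[0](mulr0 (
  if (linp (nuv x) (Nv x)).[a] == 0 then (Nv x)%:R^-1 else 0)).
apply: has_valueM; first exact: pole_coef_lin.
have -> : 2 - (valency x)%:R = (Posz 2 - (valency x)%:Z)%:~R :> ratfun.
  by rewrite rmorphB /= -!pmulrn.
rewrite -[0](mulr0 (Posz 2 - (valency x)%:Z)%:~R).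
exact: has_valueM (has_value_int _) has_value_uniformizer.
Qed.

Lemma nonneg_edge_term x y : 0 <= edge_det x y -> nonneg_coef2 (edge_term x y).
Proof.
by move=> d0; apply: nonneg_lin_lin (has_value_int _); rewrite ler0z.
Qed.

Lemma pos_edge_term x y : 0 < edge_det x y -> (0 < Nv x)%N -> (0 < Nv y)%N ->
  (linp (nuv x) (Nv x)).[a] = 0 -> (linp (nuv y) (Nv y)).[a] = 0 ->
  pos_coef2 (edge_term x y).
Proof.
by move=> d0 *; apply: pos_lin_lin (has_value_int _) _ _ _ _; rewrite ?ltr0z.
Qed.

End Terms.
End Local.

(** * Positivity and the theorem *)

Lemma Nv_gt0 (G : diagram) (v : G) : splice_diagram G -> (0 < Nv v)%N.
Proof.
move=> [[_ _ wt_gt0 _ _] [l ll ml]].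
rewrite /Nv (bigD1 l) //= ltn_addr // muln_gt0 ml.
apply: prodn_cond_gt0 => z /andP[nz _].
by apply: prodn_cond_gt0 => u /andP[zu _]; apply: wt_gt0.
Qed.

Lemma special_sym (G : diagram) : is_tree G -> symmetric (@special G).
Proof.
by move=> hT x y; rewrite /special (adjC hT); congr (_ && _); rewrite andbC.
Qed.

Lemma pos_coef2_zeta (G : diagram) (x y : G) (a : rat) :
  splice_diagram G -> special x y -> pos_coef2 a (edge_term x y) ->
  pos_coef2 a (zeta G).
Proof.
move=> [[hT _ _ _ det_gt0] _].
(* [zeta] lists each special edge once, from lower to higher rank. *)
wlog lt_xy : x y / (enum_rank x < enum_rank y)%N => [H sxy|sxy hxy].
  case: (ltngtP (enum_rank x) (enum_rank y)) => [||/val_inj /enum_rank_inj e].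
  - by move=> /H; apply.
  - by move=> /H; rewrite (special_sym hT) edge_termC; apply.
  by move: sxy; rewrite e /special (adjxx hT).
have nn (u u' : G) : special u u' && (enum_rank u < enum_rank u')%N ->
    nonneg_coef2 a (edge_term u u').
  by move=> /andP[/det_gt0/ltW d0 _]; apply: nonneg_edge_term.
rewrite /zeta addrC; apply: pos_coef2D; last first.
  by apply: nonneg_coef2_sum => u _; apply: nonneg_node_term.
apply: (pos_coef2_sum (j := x)) => // [u _|].
  by apply: nonneg_coef2_sum => u'; apply: nn.
by apply: (pos_coef2_sum (j := y)); [exact: nn | rewrite sxy | ].
Qed.

Lemma contribution_identity (K : fieldType) (d d' D D' q X X' Y Y' : K) :
  X != 0 -> Y != 0 -> Y' != 0 ->
  Y = d * X' + D * X -> Y' = d' * X + D' * X' -> q = d * d' - D * D' ->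
  q / (Y * Y') = d / (Y * X) - D' * (X^-1 * Y'^-1).
Proof.
move=> X0 Y0 Y0' eY eY' ->; move: Y0 Y0'; rewrite eY eY' => Y0 Y0'.
by field; rewrite X0 Y0 Y0'.
Qed.

Lemma horner_linp_comb (d D : nat) (i j : int) (N M : nat) (a : rat) :
  (linp (d%:Z * i + D%:Z * j) (d * N + D * M)).[a]
  = d%:R * (linp i N).[a] + D%:R * (linp j M).[a].
Proof.
by rewrite !horner_linp rmorphD !rmorphM /= natrD !natrM -!pmulrn; ring.
Qed.

Lemma horner_linp_root (G : diagram) (v w : G) (a : rat) :
  is_tree G -> special v w ->
  (linp (nuv v) (Nv v)).[a]
  = (wt v w)%:R * (linp (idx_br w v) (mult_br w v)).[a]
    + (other_weights v w)%:R * (linp (idx_br v w) (mult_br v w)).[a].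
Proof.
move=> hT /and3P[vw nv _]; rewrite (nuv_root hT vw nv) (Nv_root hT vw nv).
exact: horner_linp_comb.
Qed.

(** Eliminating [X'] from the two forms leaves [q X], with [q] the determinant. Conversely, [X = 0]
    in the first form forces [X' = 0] because [d] is nonzero. *)
Lemma linear_system_eq0 (K : fieldType) (d d' D D' X X' : K) :
  d != 0 -> d * d' - D * D' != 0 -> d * X' + D * X = 0 ->
  d' * X + D' * X' = 0 <-> X = 0.
Proof.
move=> d0 q0 eY; split=> [eY'|eX].
  apply: (mulfI q0); rewrite mulr0.
  have -> : (d * d' - D * D') * X
    = d * (d' * X + D' * X') - D' * (d * X' + D * X) by ring.
  by rewrite eY eY' !mulr0 subrr.
move: eY; rewrite eX !mulr0 addr0 add0r => /eqP.
by rewrite mulf_eq0 (negPf d0) => /eqP ->; rewrite mulr0.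
Qed.

Lemma linp_br_eq0 (G : diagram) (v w : G) (a : rat) :
  splice_diagram G -> special v w ->
  (linp (nuv v) (Nv v)).[a] = 0 ->
  (linp (nuv w) (Nv w)).[a] = 0 <-> (linp (idx_br v w) (mult_br v w)).[a] = 0.
Proof.
move=> [[hT _ wt_gt0 _ det_gt0] _] hvw; have /and3P[vw nv nw] := hvw.
have hwv : special w v by rewrite (special_sym hT).
have d0 : (wt v w)%:R != 0 :> rat by rewrite pnatr_eq0 -lt0n wt_gt0.
have q0 : (wt v w)%:R * (wt w v)%:R
    - (other_weights v w)%:R * (other_weights w v)%:R != 0 :> rat.
  have := det_gt0 _ _ hvw; rewrite -(ltr0z rat) /edge_det rmorphB /= -!pmulrn.
  by rewrite !natrM => /lt0r_neq0.
move=> eY; have eY' := horner_linp_root a hT hwv.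
have [h1 h2] :=
  linear_system_eq0 d0 q0 (etrans (esym (horner_linp_root a hT hvw)) eY).
split=> [h|h]; first exact: h1 (etrans (esym eY') h).
exact: etrans eY' (h2 h).
Qed.

Theorem theorem3p2p4 (G : diagram) (vL vR : G)
  (hG : splice_diagram G) (he : special vL vR)
  (hZ : zeta_defined G)
  (hZL : zeta_defined (splice vL vR))
  (hZR : zeta_defined (splice vR vL)) :
  let GL := splice vL vR in
  let GR := splice vR vL in
  let wL : GL := splice_root vL vR in
  let a : rat := - ((nuv vL)%:~R / (Nv vL)%:R) in
  [/\ zeta G = zeta GL + zeta GR
               - 1 / (lin (idx_br vL vR) (mult_br vL vR)
                      * lin (idx_br vR vL) (mult_br vR vL)),
      has_pole (contribution vL) a 2 <-> has_pole (contribution wL) a 2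
    & ~ has_pole (zeta G) a 2 ->
      exists r : rat,
        has_residue (contribution vL) a r /\ has_residue (contribution wL) a r].
Proof.
move=> GL GR wL a; have [[hT _ wt_gt0 _ det_gt0] _] := hG.
have /and3P[vw nv nw] := he; have wv : adj vR vL by rewrite (adjC hT).
have he' : special vR vL by rewrite (special_sym hT).
have lin_neq0 (x : G) : lin (nuv x) (Nv x) != 0.
  by apply/eqP => /lin_eq0 [_ N0]; have := Nv_gt0 x hG; rewrite N0.
have X0 : lin (idx_br vL vR) (mult_br vL vR) != 0 by apply: lin_br_neq0.
have X0' : lin (idx_br vR vL) (mult_br vR vL) != 0 by apply: lin_br_neq0.
have Ya : (linp (nuv vL) (Nv vL)).[a] = 0.
  rewrite horner_linp /a mulrN mulrC divfK ?subrr //.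
  by rewrite pnatr_eq0 -lt0n Nv_gt0.
have eC := contribution_cut hT he; have eCL := contribution_splice hT he.
rewrite -/wL in eCL; move: eC eCL.
(* [T] is the part shared by both contributions, and [c] is the term of the new leaf. *)
set T := node_term vL + _; set c := _ / _ => eC eCL.
have T_ge0 : nonneg_coef2 a T.
  apply: nonneg_coef2D; first exact: nonneg_node_term.
  apply: nonneg_coef2_sum => y /andP[_ ny]; rewrite /link.
  case: ifP => vy; last by exists 0; rewrite ?mul0r //; apply: has_value0.
  by apply: nonneg_edge_term; apply/ltW/det_gt0; rewrite /special vy nv ny.
have Xa_Ya' := linp_br_eq0 hG he Ya.
(* Both (2) and (3) follow from this dichotomy on whether [X] vanishes at [a]: either double poles
   everywhere, or a regular difference. *)
have key : [/\ pos_coef2 a (contribution vL), pos_coef2 a (contribution wL)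
               & pos_coef2 a (zeta G)]
    \/ exists2 g, regular_at g a & contribution vL = contribution wL + g.
  have [Xa|Xa] := eqVneq (linp (idx_br vL vR) (mult_br vL vR)).[a] 0; [left|right].
    have e_gt0 : pos_coef2 a (edge_term vL vR).
      apply: (pos_edge_term (det_gt0 _ _ he) (Nv_gt0 vL hG) (Nv_gt0 vR hG) Ya).
      exact/Xa_Ya'.
    split; last exact: pos_coef2_zeta e_gt0.
      by rewrite eC addrC; apply: pos_coef2D.
    rewrite eCL addrC; apply: pos_coef2D => //.
    apply: pos_lin_lin (has_value_nat a _) _ _ Ya (Xa).
    - by rewrite ltr0n wt_gt0.
    - exact: Nv_gt0.
    (* With [M = 0], vanishing at [a] would give [i = 0] and thus [X = 0] identically. *)
    rewrite lt0n; apply/eqP => M0; move: X0 Xa.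
    rewrite horner_linp /lin M0 mulr0 mul0r !addr0 => i0 /eqP.
    by rewrite intr_eq0 => /eqP i0'; rewrite i0' eqxx in i0.
  have Ya' : (linp (nuv vR) (Nv vR)).[a] != 0.
    by apply: contraNneq Xa => /Xa_Ya' ->.
  (* The difference is [- D' / (X Y')], from the second form of the edge term. *)
  exists (- ((other_weights vR vL)%:R
    * ((lin (idx_br vL vR) (mult_br vL vR))^-1 * (lin (nuv vR) (Nv vR))^-1))).
    rewrite -mulNr !linE; apply: has_value_regular; apply: has_valueM.
      have := has_value_int a (- (other_weights vR vL)%:Z).
      by rewrite rmorphN /= -pmulrn; apply.
    exact: has_valueM (has_value_inv Xa) (has_value_inv Ya').
  rewrite eC eCL -[RHS]addrA; congr (_ + _).
  exact: (contribution_identity X0 (lin_neq0 _) (lin_neq0 _) (lin_root hT vw nv)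
    (lin_root hT wv nw) (edge_det_weights vL vR)).
split; first exact: (zeta_splice hT he (lin_neq0 _) (lin_neq0 _) X0 X0').
  case: key => [[p1 p2 _]|[g g_reg ->]].
    by split=> _; apply: pos_coef2_has_pole.
  split=> [h|]; last exact: has_pole2_addr.
  rewrite -[contribution wL](addrK g); apply: has_pole2_addr h.
  by rewrite -[- g]add0r; apply: regular_atB => //;
     apply/has_value_regular/has_value0.
move=> no_pole; case: key => [[_ _ /pos_coef2_has_pole //]|[g g_reg e]].
(* The pole has order at most two, so two expansion steps produce a residue; the regular difference
   [g] leaves it unchanged. *)
have [s _ hs] : nonneg_coef2 a (contribution wL).
  rewrite eCL; apply: nonneg_coef2D => //.
  exact: nonneg_lin_lin (has_value_nat a _).
have [r hr] := has_residue_exists hs.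
by exists r; split=> //; rewrite e; apply: has_residue_addr.
Qed.
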